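(* Let $\Gamma$ be a (countable discrete) sofic group, let $\Gamma \curvearrowright^a X$ be a topological $\Gamma$-system and let $\Sigma$ be a sofic approximation to $\Gamma$. If $h^{\mathrm{tp}}_{\mathrm{nv}}(\Gamma \curvearrowright^a X) = 0$, then $h^{\mathrm{tp}}_{\Sigma}(\Gamma \curvearrowright^a X) \leq 0$.
   Context: $\Gamma$ is a countable discrete group. A topological $\Gamma$-system $\Gamma \curvearrowright^a X$ consists of a compact metrizable space $X$ and a homomorphism $a:\Gamma\to \mathrm{Homeo}(X)$; write $\gamma^a$ for $a(\gamma)$. Naive topological entropy. For an open cover $\mathscr{U}$ of $X$, $N(\mathscr{U})$ is the minimal cardinality of a subcover. The join of finitely many open covers is the cover consisting of all intersections of one element from each. Put $\gamma^a\mathscr{U}=\{\gamma^a U: U\in\mathscr{U}\}$ and, for finite $F\subseteq\Gamma$, $\mathscr{U}^F=\bigvee_{\gamma\in F}\gamma^a\mathscr{U}$. Define $h^{\mathrm{tp}}_{\mathrm{nv}}(\mathscr{U})=\inf_F \frac{1}{|F|}\log N(\mathscr{U}^F)$, the infimum over all nonempty finite $F\subseteq\Gamma$, and $h^{\mathrm{tp}}_{\mathrm{nv}}(\Gamma\curvearrowright^a X)=\sup\{h^{\mathrm{tp}}_{\mathrm{nv}}(\mathscr{U}) : \mathscr{U}\text{ a finite open cover of }X\}$. Sofic approximations. Let $[n]=\{1,\dots,n\}$, let $u_n$ be the uniform probability measure on $[n]$ and $\mathrm{Sym}(n)$ the symmetric group of $[n]$. For a function $\sigma:\Gamma\to\mathrm{Sym}(n)$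 write $\gamma^\sigma m=\sigma(\gamma)(m)$. A sofic approximation to $\Gamma$ is a sequence $\Sigma=(\sigma_i)_{i=1}^\infty$ of functions (not necessarily homomorphisms) $\sigma_i:\Gamma\to\mathrm{Sym}(n_i)$ with $n_i\to\infty$ such that for all $\gamma_1,\gamma_2\in\Gamma$, $\lim_{i} u_{n_i}(\{m\in[n_i]:(\gamma_1\gamma_2)^{\sigma_i}m=\gamma_1^{\sigma_i}\gamma_2^{\sigma_i}m\})=1$, and for all $\gamma_1\neq\gamma_2$ in $\Gamma$, $\lim_i u_{n_i}(\{m\in[n_i]:\gamma_1^{\sigma_i}m\neq\gamma_2^{\sigma_i}m\})=1$. $\Gamma$ is sofic if it has a sofic approximation. Topological sofic entropy. Fix a compatible metric $d$ on $X$. For maps $\phi,\psi:[n]\to X$ put $d^2(\phi,\psi)=\left(\frac1n\sum_{m=1}^n d(\phi(m),\psi(m))^2\right)^{1/2}$ and $d^\infty(\phi,\psi)=\max_{m\in[n]}d(\phi(m),\psi(m))$. For finite $F\subseteq\Gamma$, $\delta>0$ and $\sigma:\Gamma\to\mathrm{Sym}(n)$, $\mathrm{Map}(\sigma,F,\delta)$ is the set of $\phi:[n]\to X$ with $d^2(\phi\circ\gamma^\sigma,\gamma^a\circ\phi)\le\delta$ for all $\gamma\in F$. For a metric space $(Y,\rho)$, $\mathrm{Sep}(Y,\epsilon,\rho)$ is the maximal cardinality of a set $S\subseteq Y$ with $\rho(y_1,y_2)\ge\epsilon$ for all distinct $y_1,y_2\in S$. With $\log 0=-\infty$, define $$h^{\mathrm{tp}}_\Sigma(\delta,F,\epsilon)=\limsup_{i\to\infty}\frac1{n_i}\log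 \mathrm{Sep}(\mathrm{Map}(\sigma_i,F,\delta),\epsilon,d^\infty),$$ $h^{\mathrm{tp}}_\Sigma(F,\epsilon)=\inf_{\delta>0}h^{\mathrm{tp}}_\Sigma(\delta,F,\epsilon)$, $h^{\mathrm{tp}}_\Sigma(\epsilon)=\inf_F h^{\mathrm{tp}}_\Sigma(F,\epsilon)$ (over nonempty finite $F\subseteq\Gamma$), and $h^{\mathrm{tp}}_\Sigma(\Gamma\curvearrowright^a X)=\sup_{\epsilon>0}h^{\mathrm{tp}}_\Sigma(\epsilon)$. *)

(* Defs.v *)
From mathcomp Require Export all_boot all_order all_algebra fingroup perm.
From mathcomp Require Export finmap.
From mathcomp Require Export all_classical all_reals all_analysis.

Set Implicit Arguments.
Unset Strict Implicit.
Unset Printing Implicit Defensive.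

Import Order.TTheory GRing.Theory Num.Theory.
Import numFieldNormedType.Exports.

Local Open Scope classical_set_scope.
Local Open Scope ring_scope.

Definition is_homeo (X : topologicalType) (f : X -> X) : Prop :=
  continuous f /\
  exists f' : X -> X, [/\ continuous f', cancel f f' & cancel f' f].

Definition is_top_action (G : groupType) (X : topologicalType)
    (a : G -> X -> X) : Prop :=
  (forall g, is_homeo (a g)) /\ (forall g h, a (g * h)%g = a g \o a h).

Section NaiveEntropy.
Variables (R : realType) (G : groupType) (X : topologicalType).

Definition is_open_cover (U : set (set X)) : Prop :=
  (forall V, U V -> open V) /\ cover U id = [set: X].

(* [counting S] is the cardinality of [S], equal to [+oo] for infinite [S]. *)
Definition min_subcover (U : set (set X)) : \bar R :=
  ereal_inf [set counting S | S in [set S | S `<=` U /\ cover S id = [set: X]]].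

Definition translate (a : G -> X -> X) (g : G) (U : set (set X)) :
    set (set X) :=
  [set a g @` V | V in U].

Definition join_covers (F : {fset G}) (Us : G -> set (set X)) :
    set (set X) :=
  [set \bigcap_(g in [set` F]) V g |
    V in [set V : G -> set X | forall g, g \in F -> Us g (V g)]].

Definition iterated_cover (a : G -> X -> X) (U : set (set X)) (F : {fset G}) :
    set (set X) :=
  join_covers F (fun g => translate a g U).

Definition naive_entropy_cover (a : G -> X -> X) (U : set (set X)) : \bar R :=
  ereal_inf [set ((#|` F|%:R)^-1%:E * lne (min_subcover (iterated_cover a U F)))%E
            | F in [set F : {fset G} | F != fset0]].

Definition naive_entropy (a : G -> X -> X) : \bar R :=
  ereal_sup [set naive_entropy_cover a U
            | U in [set U | finite_set U /\ is_open_cover U]].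

End NaiveEntropy.

Section SoficApproximation.
Variables (R : realType) (G : groupType).

Definition unif (n : nat) (A : {set 'I_n}) : R := #|A|%:R / n%:R.

Definition sofic_approximation (n : nat -> nat)
    (sigma : forall i, G -> 'S_(n i)) : Prop :=
  [/\ n @ \oo --> \oo,
      forall g1 g2 : G,
        unif [set m | sigma i (g1 * g2)%g m == sigma i g1 (sigma i g2 m)]%SET
          @[i --> \oo] --> (1 : R)
    & forall g1 g2 : G, g1 <> g2 ->
        unif [set m | sigma i g1 m != sigma i g2 m]%SET @[i --> \oo] --> (1 : R)].

Definition sofic : Prop :=
  exists (n : nat -> nat) (sigma : forall i, G -> 'S_(n i)),
    sofic_approximation sigma.

End SoficApproximation.

Section SoficEntropy.
Variables (R : realType) (G : groupType) (X : metricType R).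

Definition dist2 (n : nat) (phi psi : 'I_n -> X) : R :=
  Num.sqrt (n%:R^-1 * \sum_(m < n) mdist (phi m) (psi m) ^+ 2).

Definition distoo (n : nat) (phi psi : 'I_n -> X) : R :=
  \big[Num.max/0]_(m < n) mdist (phi m) (psi m).

Definition Map (a : G -> X -> X) (n : nat) (sigma : G -> 'S_n)
    (F : {fset G}) (delta : R) : set ('I_n -> X) :=
  [set phi : 'I_n -> X | forall g, g \in F -> dist2 (phi \o sigma g) (a g \o phi) <= delta].

Definition Sep (T : choiceType) (Y : set T) (eps : R) (rho : T -> T -> R) :
    \bar R :=
  ereal_sup [set counting S | S in [set S | S `<=` Y /\
    forall y1 y2 : T, S y1 -> S y2 -> y1 <> y2 -> eps <= rho y1 y2]].

Variables (a : G -> X -> X) (n : nat -> nat) (sigma : forall i, G -> 'S_(n i)).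

Definition sofic_entropy_at (delta : R) (F : {fset G}) (eps : R) : \bar R :=
  limn_esup (fun i =>
    ((n i)%:R^-1%:E * lne (Sep (Map a (sigma i) F delta) eps (@distoo (n i))))%E).

Definition sofic_entropy_set (F : {fset G}) (eps : R) : \bar R :=
  ereal_inf [set sofic_entropy_at delta F eps | delta in [set delta | 0 < delta]].

Definition sofic_entropy_scale (eps : R) : \bar R :=
  ereal_inf [set sofic_entropy_set F eps
            | F in [set F : {fset G} | F != fset0]].

Definition sofic_entropy : \bar R :=
  ereal_sup [set sofic_entropy_scale eps | eps in [set eps | 0 < eps]].

End SoficEntropy.

(* Main.v *)
(* Given a scale eps, choose by naive entropy zero a finite set F such that few
   cells suffice to determine g^-1 x up to eps / 2 for all g in F. Adding points
   greedily gives a set C of size O(n / |F|) such that the translates of C by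
   F^-1 cover all but a small fraction of [n]. An approximately equivariant map
   phi : [n] -> X is then determined up to eps by the cells of phi(c) for c in C
   at which phi is nearly equivariant, together with the eps / 2-labels of phi at
   the few points these translates miss. *)
Require Import Defs.
From mathcomp Require Import ring lra.

Set Implicit Arguments.
Unset Strict Implicit.
Unset Printing Implicit Defensive.

Import Order.TTheory GRing.Theory Num.Theory.
Import numFieldNormedType.Exports.
Local Open Scope classical_set_scope.
Local Open Scope ring_scope.

(** * Thin sets of centres whose translates fill most of [n] *)

Definition orbit_union (I : finType) (n : nat) (s : I -> 'S_n)
    (C : {set 'I_n}) : {set 'I_n} :=
  \bigcup_(c in C) [set s g c | g : I]%SET.

(** Take [C] of largest cardinality among the sets whose translates fill at least the fraction [k]
    of the maximal size [#|I| * #|C|]. By maximality no further centre adds more than [k * #|I|] new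
    points, and averaging this over all centres bounds the uncovered part. *)
Lemma exists_thin_cover (R : realFieldType) (I : finType) (n : nat)
    (s : I -> 'S_n) (k : R) : 0 < k -> (0 < #|I|)%N ->
  exists C : {set 'I_n}, k * #|I|%:R * #|C|%:R <= n%:R /\
    #|~: orbit_union s C|%:R <=
      k * n%:R + #|[set m | ~~ injectiveb (fun g => s g m)]%SET|%:R.
Proof.
move=> k0 I0.
have P0 : k * #|I|%:R * #|(finset.set0 : {set 'I_n})|%:R <= #|orbit_union s finset.set0|%:R.
  by rewrite cards0 mulr0.
pose PC (C : {set _}) : bool := k * #|I|%:R * #|C|%:R <= #|orbit_union s C|%:R.
case: (@arg_maxnP _ (finset.set0 : {set 'I_n}) PC (fun C : {set 'I_n} => #|C|) P0) => C PCC maxC.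
exists C; split.
  by apply: (le_trans PCC); rewrite ler_nat (leq_trans (max_card _))// card_ord.
set W := (~: _)%SET; set bad := [set m | _]%SET.
(* A centre outside [C] with more than [k * #|I|] translates in [W] could be added to [C] without
   violating [PC], against maximality. *)
have small c : #|[set s g c | g : I]%SET :&: W|%:R <= k * #|I|%:R.
  have [cC|cC] := boolP (c \in C).
    rewrite (_ : _ :&: _ = finset.set0)%SET ?cards0 ?mulr_ge0 ?(ltW k0)//.
    apply/setP => p; rewrite !inE; apply/negP => /andP[pc /finset.bigcupP[]].
    by exists c.
  rewrite leNgt; apply/negP => lt_c.
  suff PcC : PC (c |: C)%SET by have := maxC _ PcC; rewrite cardsU1 cC add1n /= ltnn.
  rewrite /PC cardsU1 cC add1n -natr1 mulrDr mulr1.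
  have -> : orbit_union s (c |: C) = (orbit_union s C :|: ([set s g c | g : I]%SET :&: W))%SET.
    rewrite /orbit_union finset.bigcup_setU big_set1 finset.setUC; apply/setP => p.
    by rewrite !inE; case: (p \in \bigcup_(c in C) _)%SET; rewrite ?andbF ?andbT.
  rewrite cardsU (_ : orbit_union s C :&: _ = finset.set0)%SET; last first.
    by apply/setP => p; rewrite !inE andbA andbAC andbN.
  by rewrite cards0 subn0 natrD lerD// ltW.
(* The bound [small] counts points, while here indices [g] are counted. The two agree when [g] maps
   injectively to [s g c]; at the other centres the trivial bound [#|I|] is paid. *)
have count c : (\sum_(g : I) (s g c \in W))%:R <= k * #|I|%:R + (#|I| * (c \in bad))%:R.
  have [cb|cb] := boolP (c \in bad).
    rewrite muln1 -[leLHS]add0r lerD ?mulr_ge0 ?(ltW k0)// ler_nat.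
    by rewrite -sum1_card leq_sum// => g _; case: (_ \in _).
  rewrite muln0 addr0 (le_trans _ (small c))// ler_nat.
  move: cb; rewrite inE negbK => /injectiveP injc.
  rewrite -big_mkcond sum1_card -(card_imset _ injc) subset_leq_card//=.
  apply/fintype.subsetP => p /imsetP[g gW ->].
  by apply/finset.setIP; split; [exact: imset_f|exact: gW].
(* Double counting: each [s g] is a permutation, so each [g] contributes exactly [#|W|] centres. *)
have dbl : (\sum_(c < n) \sum_(g : I) (s g c \in W) = #|I| * #|W|)%N.
  rewrite exchange_big -sum_nat_const; apply: eq_bigr => g _.
  rewrite -(card_preimset W (@perm_inj _ (s g))) -sum1_card [in RHS]big_mkcond.
  by apply: eq_bigr => c _; rewrite [c \in _]inE; case: (_ \in W).
rewrite -(@ler_pM2l _ #|I|%:R) ?ltr0n// -natrM -dbl natr_sum.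
apply: (le_trans (ler_sum _ (fun c _ => count c))).
rewrite big_split/= sumr_const card_ord -natr_sum -big_distrr/= mulrDr -natrM.
rewrite lerD//; first by rewrite -[leLHS]mulr_natr mulrA (mulrC k).
rewrite ler_nat leq_mul2l (_ : (\sum_(i < n) _ = #|bad|)%N) ?leqnn ?orbT//.
by rewrite -sum1_card [RHS]big_mkcond; apply: eq_bigr => c _; case: (_ \in _).
Qed.

(** * Coding maps by finite data and counting their defects *)

Lemma Sep_le_card (R : realType) (T : choiceType) (Tc : finType) (Y : set T)
    (eps : R) (rho : T -> T -> R) (code : T -> Tc) :
  (forall x y, Y x -> Y y -> code x = code y -> rho x y < eps) ->
  (Sep Y eps rho <= #|Tc|%:R%:E)%E.
Proof.
move=> sep_code; apply: ge_ereal_sup => _ [S [SY Ssep] <-].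
have inj : {in S &, injective code}.
  move=> x y; rewrite !inE => Sx Sy xy; apply: contrapT => neq.
  by have := Ssep _ _ Sx Sy neq; rewrite leNgt sep_code//; apply: SY.
(* [counting] is +oo on infinite sets, so finiteness has to be derived from the injection before
   cardinalities are compared. *)
have Sfin : finite_set S.
  have /injfunPex[f] : exists2 f : T -> Tc, set_fun S setT f & set_inj S f.
    by exists code.
  exact: card_le_finite (inj_card_le f) finite_finset.
rewrite /counting asboolT// lee_fin ler_nat.
rewrite -(size_map code) cardE uniq_leq_size//.
  rewrite map_inj_in_uniq ?fset_uniq// => x y.
  by rewrite !in_fset_set//; exact: inj.
by move=> x _; rewrite mem_enum.
Qed.

Lemma card_bigcup_le (I T : finType) (P : pred I) (A : I -> {set T}) :
  (#|\bigcup_(i | P i) A i|%SET <= \sum_(i | P i) #|A i|)%N.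
Proof.
elim/big_ind2: _ => [|B b D d leB leD|//]; first by rewrite cards0.
by rewrite cardsU (leq_trans (leq_subr _ _))// leq_add.
Qed.

Lemma card_orbit_union_le (I : finType) (n : nat) (s : I -> 'S_n) (C : {set 'I_n}) :
  (#|orbit_union s C| <= #|I| * #|C|)%N.
Proof.
rewrite mulnC -sum_nat_const /orbit_union.
apply: (leq_trans (card_bigcup_le _ _)).
by apply: leq_sum => c _; exact: leq_imset_card.
Qed.

Section Coding.
Variables (R : realType) (X : metricType R) (I K L : finType) (n : nat).
Variables (s : I -> 'S_n) (b : I -> X -> X) (lab : X -> K) (cell : X -> L).
Variables (eps : R) (C : {set 'I_n}) (q : nat).
Hypothesis eps0 : 0 < eps.
Hypothesis labP : forall x y, lab x = lab y -> mdist x y < eps.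
Hypothesis cellP : forall x y, cell x = cell y ->
  forall g, mdist (b g x) (b g y) < eps / 2.

Definition bad_set (phi : 'I_n -> X) : {set 'I_n} :=
  [set c | [exists g, eps / 4 < mdist (phi (s g c)) (b g (phi c))]]%SET.

Definition uncoded (phi : 'I_n -> X) : {set 'I_n} :=
  ~: orbit_union s (C :\: bad_set phi).

(** Dropping a bad centre loses at most its [#|I|] translates. *)
Lemma card_uncoded_le phi :
  (#|uncoded phi| <= #|~: orbit_union s C| + #|I| * #|bad_set phi|)%N.
Proof.
have /subset_leq_card sub : uncoded phi \subset
    (~: orbit_union s C :|: orbit_union s (bad_set phi))%SET.
  apply/fintype.subsetP => p; rewrite !inE => p_unc.
  rewrite -implybE; apply/implyP => /finset.bigcupP[c cC pc].
  have [cbad|cgood] := boolP (c \in bad_set phi).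
    by apply/finset.bigcupP; exists c.
  by case/negP: p_unc; apply/finset.bigcupP; exists c => //; rewrite inE cgood.
rewrite (leq_trans sub)// cardsU (leq_trans (leq_subr _ _))// leq_add2l.
exact: card_orbit_union_le.
Qed.

(** The value [None] in the first factor marks the bad centres, so this factor alone determines
    [uncoded phi]. The second factor can therefore list labels without naming the points that carry
    them; [onth] pads the list with [None] up to the fixed length [q]. *)
Definition code (phi : 'I_n -> X) :
    {ffun {c | c \in C} -> option L} * {ffun 'I_q -> option K} :=
  ([ffun c => if val c \in bad_set phi then None else Some (cell (phi (val c)))],
   [ffun j : 'I_q => omap (fun p => lab (phi p)) (onth (enum (uncoded phi)) j)]).

(** Equal codes give the same uncoded set, where labels settle the matter. Any other point is
    [s g c] with [c] good for both maps, and the distance there is less than eps/4 + eps/2 +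
    eps/4. *)
Lemma code_inj phi psi : (#|uncoded phi| <= q)%N ->
  code phi = code psi -> distoo phi psi < eps.
Proof.
move=> phi_q [/ffunP eq1 /ffunP eq2].
have eq_bad c : c \in C -> (c \in bad_set phi) = (c \in bad_set psi).
  move=> cC; have := eq1 (exist _ c cC); rewrite !ffunE /=.
  by do 2 case: (_ \in bad_set _).
have eq_unc : uncoded phi = uncoded psi.
  rewrite /uncoded; congr (~: orbit_union s _)%SET; apply/setP => c.
  by rewrite !finset.in_setD; case: (boolP (c \in C)) => cC; rewrite ?andbF// eq_bad.
(* The maximum has default value 0, so [eps0] is used here too; it covers the case n = 0. *)
apply: bigmax_lt => // p _.
have [p_unc|] := boolP (p \in uncoded phi).
  have p_lt : (index p (enum (uncoded phi)) < q)%N.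
    by rewrite (leq_trans _ phi_q)// cardE index_mem mem_enum.
  have := eq2 (Ordinal p_lt); rewrite !ffunE /= -eq_unc.
  rewrite onthE (nth_map p) ?index_mem ?mem_enum// nth_index ?mem_enum// => -[].
  exact: labP.
rewrite inE negbK => /finset.bigcupP[c /finset.setDP[cC cgood]] /imsetP[g _ ->].
have := eq1 (exist _ c cC); rewrite !ffunE /= -eq_bad// (negbTE cgood) => -[].
move=> /cellP/(_ g) phi_psi.
have close (f : 'I_n -> X) : c \notin bad_set f ->
    mdist (f (s g c)) (b g (f c)) <= eps / 4.
  by rewrite inE => /existsPn/(_ g); rewrite -leNgt.
have hphi := close _ cgood.
have hpsi : mdist (psi (s g c)) (b g (psi c)) <= eps / 4.
  by apply: close; rewrite -eq_bad.
have t1 := metric_triangle (phi (s g c)) (b g (phi c)) (psi (s g c)).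
have t2 := metric_triangle (b g (phi c)) (b g (psi c)) (psi (s g c)).
rewrite (metric_sym (b g (psi c))) in t2.
by lra.
Qed.

Lemma Sep_coding (Y : set ('I_n -> X)) :
  (forall phi, Y phi -> (#|uncoded phi| <= q)%N) ->
  (Sep Y eps (@distoo R X n) <= (#|L|.+1 ^ #|C| * #|K|.+1 ^ q)%:R%:E)%E.
Proof.
move=> Yq; apply: (le_trans (@Sep_le_card _ _ _ _ _ _ code _)).
  by move=> phi psi Yphi _; apply: code_inj; exact: Yq.
by rewrite card_prod !card_ffun !card_option card_sig card_ord.
Qed.

End Coding.

(** Chebyshev's inequality for the mean square distance that defines [Map]. *)
Lemma Map_card_le (R : realType) (G : groupType) (X : metricType R)
    (a : G -> X -> X) (n : nat) (sigma : G -> 'S_n) (F : {fset G})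
    (delta t : R) phi g : 0 <= delta -> 0 <= t ->
  Map a sigma F delta phi -> g \in F ->
  t ^+ 2 * #|[set m | t < mdist (phi (sigma g m)) (a g (phi m))]%SET|%:R
    <= delta ^+ 2 * n%:R.
Proof.
move=> d0 t0 /[apply] phiF.
(* For n = 0 the factor [n%:R^-1] is 0 and cannot be cancelled, but there are no points to count. *)
have [n0|n0] := posnP n.
  rewrite (eqP (_ : #|_| == 0)%N) ?mulr0 ?mulr_ge0 ?sqr_ge0//.
  by rewrite -leqn0 (leq_trans (max_card _))// card_ord n0.
move: phiF; rewrite /dist2 => phiF.
set S := \sum_(m < n) _ in phiF.
have S0 : 0 <= S by apply: sumr_ge0 => m _; exact: sqr_ge0.
have : n%:R^-1 * S <= delta ^+ 2.
  by rewrite -(sqr_sqrtr (_ : 0 <= n%:R^-1 * S)) ?mulr_ge0// lerXn2r ?nnegrE ?sqrtr_ge0.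
rewrite -(@ler_pM2r _ n%:R) ?ltr0n// mulrAC mulVf ?pnatr_eq0 -?lt0n// mul1r.
apply: le_trans; rewrite -sum1_card natr_sum big_distrr big_mkcond/=.
apply: ler_sum => m _; rewrite inE; case: ifP => [tm|_]; last exact: sqr_ge0.
by rewrite mulr1 lerXn2r ?nnegrE ?(ltW tm)// ?mdist_ge0.
Qed.

(** * Finite covers, and few cells from zero naive entropy *)

(* [compact_cover] is only available for pointed spaces. *)
Lemma compact_finite_subcover (X : topologicalType) (f : X -> set X) :
  compact [set: X] -> (forall x, nbhs x (f x)) ->
  exists D : {fset X}, [set: X] `<=` cover [set` D] f.
Proof.
move=> /compact_near_coveringP Xcov fx.
(* Finite sets ordered by inclusion generate a filter along which each point is eventually covered,
   locally uniformly. Compactness in its near-covering form makes this uniform over [X], so a single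
   [D] works. *)
pose above (D : {fset X}) : set {fset X} := [set D' : {fset X} | {subset D <= D'}].
have aboveF : Filter (filter_from setT above).
  apply: filter_fromT_filter; first by exists fset0.
  move=> D1 D2; exists (D1 `|` D2)%fset => D' D12.
  by split => x xD; apply: D12; rewrite in_fsetU xD ?orbT.
have [x _|D _ Dcov] := Xcov _ _ (fun (D : {fset X}) x => cover [set` D] f x) aboveF.
  exists (f x, above [fset x]%fset) => /=.
    by split; [exact: fx|exists [fset x]%fset].
  move=> [x' D] /= [fx' xD]; exists x => //.
  by apply: xD; rewrite inE.
by exists D; apply: Dcov.
Qed.

Lemma exists_small_cover (R : realType) (X : metricType R) (e : R) :
  compact [set: X] -> 0 < e ->
  exists U : set (set X), [/\ finite_set U, is_open_cover U &
    forall V, U V -> forall x y, V x -> V y -> mdist x y < e].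
Proof.
move=> Xcpt e0; pose f (x : X) : set X := (ball x (e / 2))^°.
have fx x : f x x by apply: nbhsx_ballx; rewrite divr_gt0.
have [D Dcov] : exists D : {fset X}, [set: X] `<=` cover [set` D] f.
  apply: compact_finite_subcover => // x.
  by apply: open_nbhs_nbhs; split; [exact: open_interior|exact: fx].
exists (f @` [set` D]); split.
- exact/finite_image/finite_fset.
- split=> [_ [x _ <-]|]; first exact: open_interior.
  apply/seteqP; split => // x _; have [d dD dx] := Dcov x I.
  by exists (f d) => //; exists d.
- move=> _ [d _ <-] x y /interior_subset dx /interior_subset dy.
  move: dx dy; rewrite ballEmdist/= => dx dy.
  by have := metric_triangle x d y; rewrite (metric_sym x d); lra.
Qed.

(** Members of a cover may overlap, so one member is chosen at each point; this turns the cover into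
    a function with finitely many values. *)
Lemma cover_cell (T : Type) (S : set (set T)) :
  finite_set S -> cover S id = [set: T] ->
  exists cell : T -> fset_set S, forall x, val (cell x) x.
Proof.
move=> Sfin Scov.
have /choice[cell cellP] : forall x : T, exists V : fset_set S, val V x.
  move=> x; have [V SV Vx] : cover S id x by rewrite Scov.
  have VS : V \in fset_set S by rewrite in_fset_set// inE.
  by exists [` VS]%fset.
by exists cell.
Qed.

Lemma top_action_invK (G : groupType) (X : topologicalType) (a : G -> X -> X) :
  is_top_action a -> forall g, cancel (a g) (a g^-1%g).
Proof.
move=> [a_homeo aM] g x.
(* The map [a 1] is idempotent by multiplicativity and injective as a homeomorphism, hence the
   identity. *)
have a1 y : a 1%g y = y.
  have [_ [f' [_ a1K _]]] := a_homeo 1%g.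
  apply: (can_inj a1K).
  by have := aM 1%g 1%g; rewrite mulg1 => /(congr1 (@^~ y)) /= <-.
by have := aM g^-1%g g; rewrite mulVg => /(congr1 (@^~ x)) /= <-.
Qed.

Lemma naive_entropy0_cell (R : realType) (G : groupType) (X : topologicalType)
    (a : G -> X -> X) (U : set (set X)) (eta : R) :
  is_top_action a -> naive_entropy R a = 0%E ->
  finite_set U -> is_open_cover U -> 0 < eta ->
  exists (F : {fset G}) (L : finType) (cell : X -> L),
    [/\ F != fset0, #|L|%:R <= expR (eta * #|` F|%:R) &
      forall x y, cell x = cell y -> forall g, g \in F ->
        exists V, [/\ U V, V (a g^-1%g x) & V (a g^-1%g y)]].
Proof.
move=> aact a0 Ufin Ucov eta0.
have aVK := top_action_invK aact.
have : (naive_entropy_cover R a U < eta%:E)%E.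
  rewrite (@le_lt_trans _ _ 0%E) ?lte_fin// -a0.
  by apply: ereal_sup_ubound; exists U.
move=> /ereal_inf_lt[_ [F F0 <-]].
have cF : 0 < #|` F|%:R :> R by rewrite ltr0n cardfs_gt0.
set M := min_subcover _ _ => FM.
have : (M < (expR (eta * #|` F|%:R))%:E)%E.
  (* Arguing by contradiction makes [M] positive, which the monotonicity of [lne] requires. *)
  rewrite ltNge; apply/negP => leM.
  have M0 : (0 < M)%E by rewrite (lt_le_trans _ leM)// lte_fin expR_gt0.
  move: FM; rewrite ltNge => /negP; apply.
  rewrite lee_pdivlMl//.
  rewrite -EFinM -[X in (X <= _)%E](@expeRK R) lee_lne ?in_itv/= ?leey ?andbT ?(ltW M0)//.
  by rewrite mulrC.
move=> /ereal_inf_lt[_ [S [SU Scov] <-]].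
rewrite /counting; case: asboolP => // Sfin; rewrite lte_fin => ltS.
have [cell cellP] := cover_cell Sfin Scov.
exists F, (fset_set S : finType), cell; split=> //.
  by rewrite -cardfE ltW.
move=> x y xy g gF.
have /SU[W WU WE] : S (val (cell x)).
  by have := valP (cell x); rewrite in_fset_set// inE.
have := cellP y; have := cellP x; rewrite -xy -WE => Wx Wy.
have [V UV aV] := WU g gF.
exists V; split=> //.
  by have := Wx g gF; rewrite -aV => -[z Vz <-]; rewrite aVK.
by have := Wy g gF; rewrite -aV => -[z Vz <-]; rewrite aVK.
Qed.

(** * Estimates along the sofic approximation *)

(** Failure of injectivity at [m] means a coincidence for some pair of distinct indices. There are
    finitely many pairs, and asymptotic freeness makes each coincidence set a vanishing fraction of
    [n]. *)
Lemma sofic_injective_near (R : realType) (G : groupType) (n : nat -> nat)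
    (sigma : forall i, G -> 'S_(n i)) (I : finType) (h : I -> G) (k : R) :
  sofic_approximation R sigma -> injective h -> 0 < k ->
  \forall i \near \oo,
    #|[set m | ~~ injectiveb (fun g => sigma i (h g) m)]%SET|%:R <= k * (n i)%:R.
Proof.
(* The bound [k] is shared among at most [#|I| * #|I|] pairs; the successor keeps the denominator
   nonzero when [I] is empty. *)
move=> [noo _ sfree] hinj k0; set e := k / (#|I| * #|I|).+1%:R.
have e0 : 0 < e by rewrite divr_gt0.
have n_gt0 : \forall i \near \oo, (0 < n i)%N by have /cvgnyPgt := noo; apply.
pose coinc i (p : I * I) := [set m | sigma i (h p.1) m == sigma i (h p.2) m]%SET.
have : \forall i \near \oo, forall p : I * I, p.1 != p.2 ->
    #|coinc i p|%:R <= e * (n i)%:R.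
  apply: filter_forall => -[g1 g2]; have [->|g12] /= := eqVneq g1 g2.
    by near=> i.
  have /(sfree _ _)/cvgr_ge/(_ (1 - e)) : h g1 <> h g2.
    by move=> /hinj g12E; rewrite g12E eqxx in g12.
  rewrite ltrBlDr ltrDl => /(_ e0); apply: filterS2 n_gt0 => i ni0.
  rewrite /unif ler_pdivlMr ?ltr0n// mulrBl mul1r lerBlDr => le_n _.
  rewrite -(lerD2l #|[set m | sigma i (h g1) m != sigma i (h g2) m]%SET|%:R).
  apply: le_trans le_n.
  rewrite -natrD ler_nat -[leqRHS](card_ord (n i)).
  rewrite -(cardsC (coinc i (g1, g2))) addnC leq_add2l subset_leq_card//.
  by apply/fintype.subsetP => m; rewrite !inE.
apply: filterS => i coinc_le.
set bad := [set m | _]%SET.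
have /subset_leq_card badS : bad \subset
    (\bigcup_(p : I * I | p.1 != p.2) coinc i p)%SET.
  apply/fintype.subsetP => m; rewrite inE => /injectivePn[g1 [g2 g12 eq12]].
  by apply/finset.bigcupP; exists (g1, g2); rewrite // inE /= eq12.
have bad_le : (#|bad| <= \sum_(p : I * I | p.1 != p.2) #|coinc i p|)%N.
  exact: leq_trans badS (card_bigcup_le _ _).
have : #|bad|%:R <= \sum_(p : I * I | p.1 != p.2) #|coinc i p|%:R :> R.
  by rewrite -natr_sum ler_nat.
move=> /le_trans; apply.
apply: (@le_trans _ _ (\sum_(p : I * I) e * (n i)%:R)).
  rewrite big_mkcond; apply: ler_sum => p _.
  by case: ifP => [/coinc_le//|_]; rewrite mulr_ge0// ltW.
rewrite sumr_const card_prod -[leLHS]mulr_natr mulrAC ler_wpM2r//.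
by rewrite /e -mulrA ler_piMr ?(ltW k0)// mulrC ler_pdivrMr// mul1r ler_nat.
Unshelve. all: by end_near. Qed.

Lemma limn_esup_le_near (R : realType) (u : (\bar R)^nat) (l : \bar R) :
  (\forall i \near \oo, (u i <= l)%E) -> (limn_esup u <= l)%E.
Proof.
move=> ul; apply: ge_ereal_inf; exists (ereal_sup (u @` [set i | (u i <= l)%E])).
  by exists [set i | (u i <= l)%E].
by apply: ge_ereal_sup => _ [i ui <-].
Qed.

(** In [3 * k * n] one share [k * n] is the loss of the thin cover, one comes from points with
    non-injective orbits, and one from translates of bad centres. The inverses of [F] appear since
    the cells control [a g^-1]. *)
Lemma Sep_Map_le (R : realType) (G : groupType) (X : metricType R)
    (K L : finType) (lab : X -> K) (cell : X -> L) (a : G -> X -> X)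
    (n : nat) (sigma : G -> 'S_n) (F : {fset G}) (eps k delta : R) :
  0 < eps -> 0 < k -> 0 <= delta -> F != fset0 ->
  (forall x y, lab x = lab y -> mdist x y < eps) ->
  (forall x y, cell x = cell y -> forall g, g \in F ->
    mdist (a g^-1%g x) (a g^-1%g y) < eps / 2) ->
  delta ^+ 2 * #|` F|%:R ^+ 2 <= k * (eps / 4) ^+ 2 ->
  #|[set m | ~~ injectiveb (fun g : F => sigma (val g)^-1%g m)]%SET|%:R
    <= k * n%:R ->
  exists c q : nat, [/\ k * #|` F|%:R * c%:R <= n%:R, q%:R <= 3 * k * n%:R &
    (Sep (Map a sigma [fset g^-1%g | g in F]%fset delta) eps (@distoo R X n)
      <= (#|L|.+1 ^ c * #|K|.+1 ^ q)%:R%:E)%E].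
Proof.
move=> eps0 k0 d0 F0 labP cellP deltaP injP.
pose s (g : F) := sigma (val g)^-1%g; pose b (g : F) := a (val g)^-1%g.
have cF0 : (0 < #|{: F}|)%N by rewrite -cardfE cardfs_gt0.
have [C [cC unC]] := exists_thin_cover s k0 cF0.
have kn0 : 0 <= 3 * k * n%:R by rewrite !mulr_ge0// ltW.
exists #|C|, (Num.truncn (3 * k * n%:R)); split.
- by rewrite cardfE.
- by rewrite truncn_le.
apply: (@Sep_coding _ _ _ _ _ _ s b lab cell) => //.
  by move=> x y xy g; apply: cellP => //; exact: valP.
move=> phi phiMap; rewrite truncn_ge_nat//.
apply: (@le_trans _ _ (#|~: orbit_union s C| + #|{: F}| * #|bad_set s b eps phi|)%:R).
  by rewrite ler_nat; exact: card_uncoded_le.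
rewrite natrD.
(* Chebyshev is summed over the |F| sets [far g], and each bad centre costs |F| translates: hence
   the factor |F|^2 in [deltaP]. *)
suff bad_le : (#|{: F}| * #|bad_set s b eps phi|)%:R <= k * n%:R by lra.
pose far g := [set m | eps / 4 < mdist (phi (s g m)) (b g (phi m))]%SET.
have far_le g : (eps / 4) ^+ 2 * #|far g|%:R <= delta ^+ 2 * n%:R.
  apply: Map_card_le phiMap _ => //; first by rewrite divr_ge0// ltW.
  by apply: in_imfset; exact: valP.
have bad_far : (#|bad_set s b eps phi| <= \sum_g #|far g|)%N.
  have /subset_leq_card : bad_set s b eps phi \subset (\bigcup_g far g)%SET.
    apply/fintype.subsetP => m; rewrite inE => /existsP[g gm].
    by apply/finset.bigcupP; exists g; rewrite // inE.
  by move=> /leq_trans; apply; exact: card_bigcup_le.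
have e20 : 0 < (eps / 4) ^+ 2 by rewrite exprn_gt0// divr_gt0.
rewrite -(ler_pM2l e20).
apply: (@le_trans _ _ (delta ^+ 2 * #|` F|%:R ^+ 2 * n%:R)); last first.
  by rewrite [leRHS]mulrCA [leRHS]mulrA ler_wpM2r.
rewrite natrM mulrCA.
apply: (@le_trans _ _ (#|{: F}|%:R * \sum_g ((eps / 4) ^+ 2 * #|far g|%:R))).
  by rewrite ler_wpM2l// -big_distrr/= ler_wpM2l ?(ltW e20)// -natr_sum ler_nat.
apply: (@le_trans _ _ (#|{: F}|%:R * \sum_(g : F) (delta ^+ 2 * n%:R))).
  by rewrite ler_wpM2l// ler_sum.
rewrite sumr_const -[X in _ * X <= _]mulr_natr -cardfE le_eqVlt.
by apply/orP; left; apply/eqP; ring.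
Qed.

(** The case of nonpositive [x] covers an empty [Map], whose separation number is 0 with logarithm
    -oo. *)
Lemma lne_le_ln (R : realType) (x : \bar R) (M : nat) : (0 < M)%N ->
  (x <= M%:R%:E)%E -> (lne x <= (ln M%:R)%:E)%E.
Proof.
move=> M0 xM; have [x0|x0] := leP x 0%E; first by rewrite le0_lneNy// leNye.
rewrite -lne_EFin ?ltr0n// lee_lne// in_itv/= ?leey ?andbT ?(ltW x0)//.
Qed.

(** The rate [rho] is split evenly: rho/2 pays for the cells at the centres ([t1]) and rho/2 for the
    labels at uncoded points ([t2]). *)
Lemma sofic_entropy_scale_le (R : realType) (G : groupType) (X : metricType R)
    (a : G -> X -> X) (n : nat -> nat) (sigma : forall i, G -> 'S_(n i))
    (eps rho : R) :
  compact [set: X] -> is_top_action a -> sofic_approximation R sigma ->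
  naive_entropy R a = 0%E -> 0 < eps -> 0 < rho ->
  (sofic_entropy_scale a sigma eps <= rho%:E)%E.
Proof.
move=> Xcpt aact sof a0 eps0 rho0.
have e20 : 0 < eps / 2 by rewrite divr_gt0.
have [U [Ufin Ucov Usmall]] := exists_small_cover Xcpt e20.
have [lab labP] := cover_cell Ufin (proj2 Ucov).
set K : finType := fset_set U in lab labP.
pose lK : R := ln #|K|.+1%:R.
have lK0 : 0 <= lK by rewrite ln_ge0// ler1n.
(* Labels cost at most [lK * (3 * k * n)], which this choice keeps below rho n / 2; the added 1
   avoids division by zero when [lK] is 0. *)
pose k := rho / (6 * (lK + 1)).
have k0 : 0 < k by rewrite divr_gt0// mulr_gt0// ltr_wpDl.
have kE : k * (6 * (lK + 1)) = rho by rewrite mulfVK// gt_eqF// mulr_gt0// ltr_wpDl.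
(* There are at most n / (k |F|) centres, each costing [ln #|L|.+1], at most 2 eta |F|; the total is
   2 eta n / k, equal to rho n / 2 for this eta. *)
have eta0 : 0 < rho * k / 4 by rewrite divr_gt0// mulr_gt0.
have [F [L [cell [F0 cardL cellP]]]] := naive_entropy0_cell aact a0 Ufin Ucov eta0.
have cF0 : 0 < #|` F|%:R :> R by rewrite ltr0n cardfs_gt0.
have lab_lt x y : lab x = lab y -> mdist x y < eps.
  move=> xy; have := labP y; have := labP x; rewrite -xy => Vx Vy.
  rewrite (lt_trans (Usmall _ _ _ _ Vx Vy)) ?ltr_pdivrMr ?ltr_pMr ?ltr1n//.
  by have := valP (lab x); rewrite in_fset_set// inE.
have cell_lt x y : cell x = cell y -> forall g, g \in F ->
    mdist (a g^-1%g x) (a g^-1%g y) < eps / 2.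
  by move=> xy g gF; have [V [UV Vx Vy]] := cellP _ _ xy g gF; exact: Usmall UV _ _ Vx Vy.
(* The value giving equality in the hypothesis on [delta] of [Sep_Map_le]. *)
pose delta := eps / 4 * Num.sqrt k / #|` F|%:R.
have d0 : 0 < delta by rewrite !(divr_gt0, mulr_gt0)// sqrtr_gt0.
have dE : delta ^+ 2 * #|` F|%:R ^+ 2 <= k * (eps / 4) ^+ 2.
  by rewrite -exprMn /delta mulfVK ?gt_eqF// exprMn sqr_sqrtr ?(ltW k0)// mulrC.
pose E := [fset g^-1%g | g in F]%fset.
have E0 : E != fset0.
  have [g gF] := fset0Pn _ F0.
  by apply/fset0Pn; exists g^-1%g; exact: in_imfset.
apply: (@le_trans _ _ (sofic_entropy_at a sigma delta E eps)).
  apply: (@le_trans _ _ (sofic_entropy_set a sigma E eps)).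
    by apply: ereal_inf_lbound; exists E.
  by apply: ereal_inf_lbound; exists delta.
apply: limn_esup_le_near.
have n_gt0 : \forall i \near \oo, (0 < n i)%N.
  by have [/cvgnyPgt noo _ _] := sof; exact: noo.
have h_inj : injective (fun g : F => (val g)^-1%g).
  by move=> g1 g2 /invg_inj/val_inj.
apply: filterS2 n_gt0 (sofic_injective_near sof h_inj k0) => i ni0 injP.
rewrite lee_pdivrMl ?ltr0n//.
(* The estimate [lnL] absorbs the extra symbol [None] through |L| + 1 <= |L|^2, which needs |L| >=
   2. With at most one cell, any two points of [X] are closer than eps/2, so a separated set has at
   most one element. *)
have [L1|L2] := leqP #|L| 1.
  rewrite (@le_trans _ _ 0%E)// ?lee_fin ?mulr_ge0// ?(ltW rho0)//.
  rewrite lne_le0; apply: le_trans (Sep_le_card (code := fun=> tt) _) _.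
    2: by rewrite card_unit.
  move=> phi psi _ _ _.
  apply: bigmax_lt => // p _.
  have [g gF] := fset0Pn _ F0.
  rewrite -(top_action_invK aact g (phi p)) -(top_action_invK aact g (psi p)).
  rewrite (lt_trans (cell_lt _ _ _ _ gF))//.
    exact: (fintype_le1P L1).
  by rewrite ltr_pdivrMr// ltr_pMr// ltr1n.
have [c [q [cE qE SepE]]] := Sep_Map_le eps0 k0 (ltW d0) F0 lab_lt cell_lt dE injP.
apply: le_trans (lne_le_ln _ SepE) _; first by rewrite muln_gt0 !expn_gt0.
rewrite -EFinM lee_fin natrM !natrX lnM ?posrE ?exprn_gt0// !lnXn//.
have lnL : ln #|L|.+1%:R <= 2 * (rho * k / 4 * #|` F|%:R).
  have L0 : 0 < #|L|%:R :> R by rewrite ltr0n (ltn_trans _ L2).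
  apply: (@le_trans _ _ (ln (#|L|%:R ^+ 2))).
    rewrite ler_ln ?posrE ?exprn_gt0// -natrX ler_nat.
    rewrite (leq_trans (_ : _ <= 2 * #|L|)%N) ?leq_mul//.
    by rewrite mul2n -addnn -addn1 leq_add2l ltnW.
  rewrite lnXn// -[leLHS]mulr_natl ler_wpM2l//.
  by rewrite -[leRHS]expRK ler_ln// posrE expR_gt0.
rewrite -/lK -[X in X + _]mulr_natr -[X in _ + X]mulr_natr.
have t1 : ln #|L|.+1%:R * c%:R <= rho / 2 * (n i)%:R.
  apply: (@le_trans _ _ (2 * (rho * k / 4 * #|` F|%:R) * c%:R)).
    by rewrite ler_wpM2r.
  rewrite (_ : _ * _ = rho / 2 * (k * #|` F|%:R * c%:R)); last by field.
  by rewrite ler_wpM2l// divr_ge0// ltW.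
have t2 : lK * q%:R <= rho / 2 * (n i)%:R.
  apply: (@le_trans _ _ (lK * (3 * k * (n i)%:R))); first by rewrite ler_wpM2l.
  rewrite mulrA ler_wpM2r//; have := ltW k0; lra.
by rewrite (mulrC _ rho) ; lra.
Qed.

Theorem theorem1p1 (R : realType) (G : groupType) (X : metricType R)
    (a : G -> X -> X) (n : nat -> nat) (sigma : forall i : nat, G -> 'S_(n i)) :
  countable [set: G] ->
  sofic R G ->
  compact [set: X] ->
  is_top_action a ->
  sofic_approximation R sigma ->
  naive_entropy R a = 0%E ->
  (sofic_entropy a sigma <= 0)%E.
Proof.
move=> _ _ Xcpt aact sof a0; apply: ge_ereal_sup => _ [eps eps0 <-].
apply/lee_addgt0Pr => rho rho0; rewrite add0e.
exact: sofic_entropy_scale_le.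
Qed.
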